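(* Suppose $X$ is a compact Hausdorff space, $Y \in MS$, $f : X \to Y$ is continuous, and $f^{-1}\{y\}$ is scattered for every $y \in Y$. Then $X \in MS$.
   Context: All spaces are Hausdorff. $MS$ is the class of compact Hausdorff spaces $X$ such that every Radon measure (finite regular Borel measure) on $X$ is separable, where a measure is separable iff its measure algebra (Borel sets modulo null sets, with metric $d(A,B)=\mu(A\triangle B)$) is separable as a metric space. *)

(* Defs.v *)
From HB Require Import structures.
From mathcomp Require Import all_boot all_order all_algebra.
From mathcomp Require Import all_classical all_reals all_analysis.
Set Implicit Arguments.
Unset Strict Implicit.
Unset Printing Implicit Defensive.
Import Order.TTheory GRing.Theory Num.Theory.
Import numFieldNormedType.Exports.
Local Open Scope classical_set_scope.
Local Open Scope ring_scope.
Local Open Scope quotient_scope.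

Definition separable_space (T : topologicalType) : Prop :=
  exists2 D : set T, countable D & dense D.

Definition scattered (T : topologicalType) (A : set T) : Prop :=
  forall B : set T, B `<=` A -> B !=set0 -> isolated B !=set0.

Section MeasureAlgebra.
Context d (T : measurableType d) (R : realType).
Variable mu : {finite_measure set T -> \bar R}.

Definition measurable_set : Type := set_type (@measurable d T).

Lemma measurable_setP (A : measurable_set) : measurable (val A).
Proof. exact: set_mem (valP A). Qed.

Definition null_eq (A B : measurable_set) : bool := mu (val A `+` val B) == 0%E.

Definition symdiff_dist (A B : set T) : R := fine (mu (A `+` B)).

Lemma null_eqE (A B : measurable_set) :
  null_eq A B = (symdiff_dist (val A) (val B) == 0).
Proof.
rewrite /null_eq /symdiff_dist -fine_eq0 ?fin_num_measure//.
have mA := measurable_setP A; have mB := measurable_setP B.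
by apply: measurableU; exact: measurableD.
Qed.

Lemma symdiff_distxx (A : set T) : symdiff_dist A A = 0.
Proof. by rewrite /symdiff_dist setYK measure0. Qed.

Lemma symdiff_distC (A B : set T) : symdiff_dist A B = symdiff_dist B A.
Proof. by rewrite /symdiff_dist setYC. Qed.

Lemma symdiff_dist_ge0 (A B : set T) : 0 <= symdiff_dist A B.
Proof. exact: fine_ge0. Qed.

Lemma symdiff_dist_triangle (B A C : measurable_set) :
  symdiff_dist (val A) (val C) <=
  symdiff_dist (val A) (val B) + symdiff_dist (val B) (val C).
Proof.
have mA := measurable_setP A; have mB := measurable_setP B.
have mC := measurable_setP C.
have mY (E F : set T) : measurable E -> measurable F -> measurable (E `+` F).
  by move=> mE mF; apply: measurableU; exact: measurableD.
have fY (E F : set T) : measurable E -> measurable F ->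
    mu (E `+` F) \is a fin_num.
  by move=> mE mF; apply: fin_num_measure; exact: mY.
rewrite /symdiff_dist -fineD ?fY// fine_le ?fin_numD ?fY//.
apply: (@le_trans _ _ (mu ((val A `+` val B) `|` (val B `+` val C)))); last first.
  by apply: measureU2; exact: mY.
apply: le_measure; rewrite ?inE; [exact: mY| |].
  by apply: measurableU; exact: mY.
by move=> x /=; case: (pselect (val B x)); tauto.
Qed.

Lemma null_eq_refl : reflexive null_eq.
Proof. by move=> A; rewrite null_eqE symdiff_distxx. Qed.

Lemma null_eq_sym : symmetric null_eq.
Proof. by move=> A B; rewrite !null_eqE symdiff_distC. Qed.

Lemma null_eq_trans : transitive null_eq.
Proof.
move=> B A C; rewrite !null_eqE => /eqP AB /eqP BC.
rewrite eq_le symdiff_dist_ge0 andbT.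
by rewrite (le_trans (symdiff_dist_triangle B A C))// AB BC addr0.
Qed.

Canonical null_eq_equiv :=
  EquivRel null_eq null_eq_refl null_eq_sym null_eq_trans.

Definition measure_algebra : Type := {eq_quot null_eq}.
HB.instance Definition _ := Choice.on measure_algebra.
HB.instance Definition _ := EqQuotient.on measure_algebra.

Definition measure_algebra_dist (a b : measure_algebra) : R :=
  symdiff_dist (val (repr a)) (val (repr b)).

Lemma measure_algebra_distE (A B : measurable_set) :
  measure_algebra_dist (\pi_measure_algebra A) (\pi_measure_algebra B) =
  fine (mu (val A `+` val B)).
Proof.
have piP (C : measurable_set) :
    symdiff_dist (val C) (val (repr (\pi_measure_algebra C))) = 0.
  apply/eqP; rewrite -null_eqE.
  by apply/eqmodP; rewrite reprK.
rewrite -[RHS]/(symdiff_dist _ _) /measure_algebra_dist.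
set A' := repr _; set B' := repr _.
have AA' : symdiff_dist (val A) (val A') = 0 by exact: piP.
have BB' : symdiff_dist (val B) (val B') = 0 by exact: piP.
apply/eqP; rewrite eq_le; apply/andP; split.
  rewrite (le_trans (symdiff_dist_triangle A A' B'))//.
  rewrite symdiff_distC AA' add0r.
  by rewrite (le_trans (symdiff_dist_triangle B A B'))// BB' addr0.
rewrite (le_trans (symdiff_dist_triangle A' A B))// AA' add0r.
rewrite (le_trans (symdiff_dist_triangle B' A' B))//.
by rewrite [X in _ + X]symdiff_distC BB' addr0.
Qed.

Lemma measure_algebra_distxx a : measure_algebra_dist a a = 0.
Proof. exact: symdiff_distxx. Qed.

Lemma measure_algebra_dist_positivity a b :
  measure_algebra_dist a b = 0 -> a = b.
Proof.
move/eqP; rewrite -null_eqE => ab.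
by rewrite -[a]reprK -[b]reprK; apply/eqmodP.
Qed.

Lemma measure_algebra_dist_sym a b :
  measure_algebra_dist a b = measure_algebra_dist b a.
Proof. exact: symdiff_distC. Qed.

Lemma measure_algebra_dist_triangle b a c : measure_algebra_dist a c <=
  measure_algebra_dist a b + measure_algebra_dist b c.
Proof. exact: symdiff_dist_triangle. Qed.

HB.instance Definition _ := @isMetric.Build R measure_algebra
  measure_algebra_dist measure_algebra_distxx measure_algebra_dist_positivity
  measure_algebra_dist_sym measure_algebra_dist_triangle.

End MeasureAlgebra.

Definition separable_measure d (T : measurableType d) (R : realType)
    (mu : {finite_measure set T -> \bar R}) : Prop :=
  separable_space (measure_algebra mu).

(* The library's measurable types carry a distinguished point, while a
   topological space may be empty; [based x0] is the space itself with [x0] as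
   distinguished point, which affects neither its Borel sets nor its measures. *)
Definition based (T : topologicalType) (x0 : T) : Type := T.
HB.instance Definition _ (T : topologicalType) (x0 : T) :=
  Choice.on (based x0).
HB.instance Definition _ (T : topologicalType) (x0 : T) :=
  isPointed.Build (based x0) x0.

Definition borel (T : topologicalType) (x0 : T) :=
  g_sigma_algebraType (@open T : set (set (based x0))).
HB.instance Definition _ (T : topologicalType) (x0 : T) :=
  Measurable.on (borel x0).

Definition radon (R : realType) (T : topologicalType) (x0 : T)
    (mu : {finite_measure set (borel x0) -> \bar R}) : Prop :=
  forall A : set T, measurable (A : set (borel x0)) ->
    mu A = ereal_sup [set mu K | K in [set K : set T | compact K /\ K `<=` A]]
    /\
    mu A = ereal_inf [set mu U | U in [set U : set T | open U /\ A `<=` U]].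

(* On the empty space the only measure is zero, whose measure algebra is a
   point: quantifying over base points makes the last clause hold there. *)
Definition in_MS (R : realType) (T : topologicalType) : Prop :=
  [/\ hausdorff_space T, compact [set: T] &
      forall (x0 : T) (mu : {finite_measure set (borel x0) -> \bar R}),
        radon mu -> separable_measure mu].

(* Main.v *)
(* Let mu be a Radon measure on X and nu its image under f, which is separable.
   If mu is not separable, some set X1 with mu X1 > 0 contains no subset of
   positive measure on which mu is separable.  Say that a Borel set B of Y is
   charged by a set E when nu restricted to B is absolutely continuous with respect
   to the image of mu restricted to E.  If K c X1 charges B and nu B > 0, then
   K contains two disjoint compact sets charging a common B' c B with
   nu B' > 0: otherwise every measurable subset of the part of K above B would
   be, up to a null set, the trace of the preimage of a Borel set of Y, so mu
   would be separable there.  Iterating this on finite families of compact sets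
   gives a family of compact sets, each containing two disjoint members of the
   family; by compactness of Y some fiber meets all of them.  A minimal closed
   subset of that fiber meeting all of them has no isolated point. *)
Require Import Defs.
From HB Require Import structures.
From mathcomp Require Import all_boot all_order all_algebra.
From mathcomp Require Import all_classical all_reals all_analysis.
From mathcomp Require Import lra.
Set Implicit Arguments.
Unset Strict Implicit.
Unset Printing Implicit Defensive.
Import Order.TTheory GRing.Theory Num.Theory.
Import numFieldNormedType.Exports.
Local Open Scope classical_set_scope.
Local Open Scope ring_scope.
Local Open Scope quotient_scope.

(** * Exhaustion and separability *)

Section exhaustion.
Context (d : measure_display) (T : measurableType d) (R : realType).
Variable mu : {finite_measure set T -> \bar R}.

Lemma finite_measure_small_bigcap (F : (set T)^nat) (e : R) :
  (forall n, measurable (F n)) -> {homo F : m n / (m <= n)%N >-> n `<=` m} ->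
  mu (\bigcap_n F n) = 0%E -> (0 < e)%R -> exists n, (mu (F n) < e%:E)%E.
Proof.
move=> mF dF F0 e0.
have F0_fin : (mu (F 0%N) < +oo)%E.
  apply: le_lt_trans (fin_num_fun_lty (@fin_num_measure _ _ _ mu)).
  by apply: le_measure; rewrite ?inE.
have capF : measurable (\bigcap_n F n) by exact: bigcapT_measurable.
have dF' : {homo F : m n / (m <= n)%N >-> (n <= m)%O}.
  by move=> m n mn; rewrite subsetEset; exact: dF.
have [|N _ /(_ N (leqnn N))] :=
    nonincreasing_cvg_mu F0_fin mF capF dF' (t := [set x | x < e%:E]%E).
  rewrite [X in nbhs X _](F0 : _ = _).
  by apply: open_nbhs_nbhs; split=> //; exact: open_ereal_lt_ereal.
by exists N.
Qed.

(** Take [C n] in [G] with measure within 1/(n+1) of the supremum [s] over [G], and let [D n] be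
    their finite unions. For [A] in [G], the union of [C n] and [A] stays in [G], so the part of [A]
    outside [C n] has measure below 1/(n+1). *)
Lemma exhausting_sequence (G : set (set T)) :
  G set0 -> G `<=` measurable -> setU_closed G ->
  exists D : (set T)^nat,
    [/\ forall n, G (D n), {homo D : m n / (m <= n)%N >-> m `<=` n} &
        forall A, G A -> mu (A `\` \bigcup_n D n) = 0%E].
Proof.
move=> G0 Gm GU; pose s := ereal_sup [set mu A | A in G].
have s_ub A : G A -> (mu A <= s)%E.
  by move=> GA; apply: ereal_sup_ubound; exists A.
have s_fin : s \is a fin_num.
  rewrite ge0_fin_numE; last by rewrite -(measure0 mu) s_ub.
  apply: le_lt_trans (fin_num_fun_lty (@fin_num_measure _ _ _ mu)).
  by apply: ge_ereal_sup => _ [A /Gm mA <-]; apply: le_measure; rewrite ?inE.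
have /choice[C HC] (n : nat) : exists C, G C /\ (s - (n.+1%:R^-1)%:E < mu C)%E.
  have n0 : (0 < n.+1%:R^-1 :> R)%R by rewrite invr_gt0.
  by have [_ [C GC <-] ?] := ub_ereal_sup_adherent n0 s_fin; exists C.
exists (fun n => \big[setU/set0]_(i < n) C i); split.
- by move=> n; elim/big_ind : _ => // i _; exact: (HC i).1.
- exact: subset_bigsetU.
move=> A GA; have mA := Gm _ GA; have mC n := Gm _ (HC n).1.
have mD : measurable (\bigcup_n \big[setU/set0]_(i < n) C i).
  by apply: bigcupT_measurable => n; exact: bigsetU_measurable.
apply/eqP; rewrite eq_le measure_ge0 andbT.
apply/lee_addgt0Pr => e e0; rewrite add0e.
have [n _ /(_ n (leqnn n)) /= ne] := near_infty_natSinv_lt (PosNum e0).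
apply: (@le_trans _ _ (mu (A `\` C n))).
  apply: le_measure; rewrite ?inE; try exact: measurableD.
  apply: setDS => x Cx; exists n.+1 => //; by rewrite big_ord_recr; right.
apply: (@le_trans _ _ (n.+1%:R^-1)%:E); last by rewrite lee_fin ltW.
have muD : (mu (C n) + mu (A `\` C n) <= s)%E.
  rewrite -measureU//; last by rewrite setDIK.
  - rewrite setUDr setDv setD0.
    by apply: s_ub; exact: GU (HC n).1 GA.
  - exact: measurableD.
have [_] := HC n; rewrite lteBlDr//.
have fC := fin_num_measure mu _ (mC n).
have fA := fin_num_measure mu _ (measurableD mA (mC n)).
move: muD; rewrite -(fineK fC) -(fineK fA) -(fineK s_fin) -!EFinD.
rewrite !lee_fin !lte_fin.
set r := n.+1%:R^-1; clearbody r. lra.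
Qed.

End exhaustion.

(** * Separability of a measure restricted to a set *)

Section separable_on.
Context (d : measure_display) (T : measurableType d) (R : realType).
Variable mu : {finite_measure set T -> \bar R}.

Lemma measurable_symdiff (A B : set T) :
  measurable A -> measurable B -> measurable (A `+` B).
Proof. by move=> mA mB; apply: measurableU; exact: measurableD. Qed.

Lemma measure_subU (A B C : set T) :
  measurable A -> measurable B -> measurable C -> A `<=` B `|` C ->
  (mu A <= mu B + mu C)%E.
Proof.
move=> mA mB mC ABC; apply: (@le_trans _ _ (mu (B `|` C))); last exact: measureU2.
by apply: le_measure; rewrite ?inE//; exact: measurableU.
Qed.

Lemma measure_subU0 (A B C : set T) :
  measurable A -> measurable B -> measurable C -> A `<=` B `|` C ->
  mu B = 0%E -> mu C = 0%E -> mu A = 0%E.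
Proof.
move=> mA mB mC ABC B0 C0; apply/eqP; rewrite eq_le measure_ge0 andbT.
by rewrite (le_trans (measure_subU mA mB mC ABC))// B0 C0 adde0.
Qed.

(** The approximants need not lie inside [A]. Indexing by a [countType] lets products and dependent
    sums serve directly as index sets. *)
Definition separable_on (A : set T) : Prop :=
  exists (I : countType) (F : I -> set T), (forall i, measurable (F i)) /\
    forall E (e : R), measurable E -> 0 < e ->
    exists i, (mu ((E `&` A) `+` F i) < e%:E)%E.

Lemma separable_on0 : separable_on set0.
Proof.
exists unit, (fun=> set0); split=> [_ //|E e _ e0].
by exists tt; rewrite setI0 setYK measure0 lte_fin.
Qed.

Lemma separable_onU (A B : set T) : measurable A -> measurable B ->
  separable_on A -> separable_on B -> separable_on (A `|` B).
Proof.
move=> mA mB [I [F [mF IF]]] [J [G [mG JG]]].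
exists (I * J)%type, (fun ij => F ij.1 `|` G ij.2).
split=> [ij|E e mE e0]; first exact: measurableU.
have e20 : 0 < e / 2 by rewrite divr_gt0.
have [i Fi] := IF E _ mE e20; have [j Gj] := JG E _ mE e20.
exists (i, j) => /=.
rewrite (splitr e) EFinD; apply: le_lt_trans (lteD Fi Gj).
have mEA := measurableI _ _ mE mA; have mEB := measurableI _ _ mE mB.
rewrite setIUr; apply: measure_subU.
- by apply: measurable_symdiff; exact: measurableU.
- exact: measurable_symdiff.
- exact: measurable_symdiff.
by move=> x /=; tauto.
Qed.

(** A set [E] differs from its trace on [A n] only outside [A n], which costs less than e/2 for
    large [n]; the approximants for all the [A n] together still form a countable family. *)
Lemma separable_on_exhaustion (A : (set T)^nat) :
  (forall n, measurable (A n)) ->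
  {homo A : m n / (m <= n)%N >-> m `<=` n} ->
  mu (~` \bigcup_n A n) = 0%E ->
  (forall n, separable_on (A n)) -> separable_on setT.
Proof.
move=> mA incrA A0 /choice[I HI].
pose F n := projT1 (cid (HI n)).
have HF n := projT2 (cid (HI n)); rewrite -/(F _) in HF.
exists {n : nat & I n}, (fun u => F (tag u) (tagged u)).
split=> [u|E e mE e0]; first exact: (HF _).1.
have e20 : 0 < e / 2 by rewrite divr_gt0.
have [n An] : exists n, (mu (~` A n) < (e / 2)%:E)%E.
  apply: finite_measure_small_bigcap => //.
  - by move=> n; exact: measurableC.
  - by move=> m n mn; apply: subsetC; exact: incrA.
  - by rewrite -setC_bigcup.
have [i Fi] := (HF n).2 E _ mE e20.
have mF := (HF n).1 i; have mEA := measurableI _ _ mE (mA n).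
exists (Tagged I i) => /=; rewrite setIT (splitr e) EFinD.
apply: le_lt_trans (lteD An Fi).
apply: measure_subU; [exact: measurable_symdiff|exact: measurableC| |].
  exact: measurable_symdiff.
by move=> x /=; case: (pselect (A n x)); tauto.
Qed.

Lemma separable_on_setT : separable_on setT -> separable_measure mu.
Proof.
move=> [I [F [mF HF]]].
pose pi A (mA : measurable A) : measure_algebra mu :=
  \pi_(measure_algebra mu) (SigSub (mem_set mA)).
exists (range (fun i => pi _ (mF i))).
  by apply: sub_countable (card_image_le _ _) _.
move=> O [a Oa] oO.
have : nbhs a O by exact: open_nbhs_nbhs.
rewrite -nbhs_ballE => -[e /= e0 aO].
have [i] := HF _ _ (measurable_setP (repr a)) e0.
rewrite setIT => aFi; exists (pi _ (mF i)); split; last by exists i.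
apply: aO; rewrite /ball/= -[a]reprK.
have -> := measure_algebra_distE mu (repr a)
  (SigSub (mem_set (mF i)) : measurable_set T).
rewrite -lte_fin fineK// fin_num_measure//.
by apply: measurable_symdiff; exact: measurable_setP.
Qed.

Lemma separable_measure_on : separable_measure mu -> separable_on setT.
Proof.
move=> [D cD dD].
(* Either [D] is empty, which density excludes because the class of the empty set exists, or [g]
   enumerates [D]. *)
have /pfcard_geP[D0|[g]] : (D #<= [set: nat])%card by [].
  have [|a [_]] := dD setT _ openT; last by rewrite D0.
  by exists (\pi_(measure_algebra mu) (SigSub (mem_set (@measurable0 _ T)))).
exists nat, (fun n => val (repr (g n))); split=> [n|E e mE e0].
  by exact: measurable_setP.
pose E' : measurable_set T := SigSub (mem_set mE).
pose a : measure_algebra mu := \pi_(measure_algebra mu) E'.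
have [||b [/interior_subset + Db]] := dD (interior (ball a e)).
- by exists a; apply: nbhs_singleton; apply: nbhs_interior; exact: nbhsx_ballx.
- exact: open_interior.
have [n _ <-] := @surj _ _ _ _ g _ Db.
rewrite /ball/= -[g n]reprK (measure_algebra_distE mu E' (repr (g n))) => aB.
exists n; rewrite setIT -[X in (X < _)%E]fineK ?lte_fin// fin_num_measure//.
by apply: measurable_symdiff => //; exact: measurable_setP.
Qed.
End separable_on.

(** * Relative absolute continuity over a measurable map *)

Section charges.
Context (d d' : measure_display) (X : measurableType d) (Y : measurableType d').
Context (R : realType) (mu : {finite_measure set X -> \bar R}) (f : X -> Y).
Hypothesis mf : measurable_fun setT f.

Definition charges (E : set X) (B : set Y) : Prop :=
  forall B', measurable B' -> B' `<=` B ->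
    mu (E `&` f @^-1` B') = 0%E -> mu (f @^-1` B') = 0%E.

Lemma measurable_preim (B : set Y) : measurable B -> measurable (f @^-1` B).
Proof. by move=> mB; rewrite -[X in measurable X]setTI; exact: mf. Qed.

Lemma charges_subset (E E' : set X) (B B' : set Y) :
  measurable E -> measurable E' -> E `<=` E' -> B' `<=` B ->
  charges E B -> charges E' B'.
Proof.
move=> mE mE' EE' BB' EB C mC CB' C0.
apply: EB => //; first exact: subset_trans BB'.
have mfC := measurable_preim mC.
apply: subset_measure0 C0; [exact: measurableI..|exact: setSI].
Qed.

(** [C] is the complement of a largest Borel set, modulo null sets, whose preimage meets [E] in a
    null set. The exhaustion runs over preimages in [X], so that size is measured by [mu]. A Borel
    subset of [C] whose preimage has null trace on [E] is absorbed by the exhaustion yet disjoint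
    from it, hence has null preimage. *)
Lemma essential_image (E : set X) : measurable E ->
  exists C, [/\ measurable C, mu (E `\` f @^-1` C) = 0%E & charges E C].
Proof.
move=> mE.
pose G := [set f @^-1` B | B in
  [set B | measurable B /\ mu (E `&` f @^-1` B) = 0%E]].
have [|||D [GD _ maxD]] := @exhausting_sequence _ _ _ mu G.
- exists set0; rewrite ?preimage_set0//.
  by split=> //; rewrite preimage_set0 setI0 measure0.
- by move=> _ [B [mB _] <-]; exact: measurable_preim.
- move=> _ _ [B [mB B0] <-] [C [mC C0] <-]; exists (B `|` C) => //.
  have mfB := measurable_preim mB; have mfC := measurable_preim mC.
  split; first exact: measurableU.
  rewrite preimage_setU setIUr; apply: measure_subU0 B0 C0 => //; try exact: measurableI.
  by apply: measurableU; exact: measurableI.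
have /choice[B HB] n : exists B,
    [/\ measurable B, mu (E `&` f @^-1` B) = 0%E & f @^-1` B = D n].
  by have [B [mB B0] <-] := GD n; exists B.
have mB n : measurable (B n) by case: (HB n).
have mUB : measurable (\bigcup_n B n) by exact: bigcupT_measurable.
have UBE : f @^-1` (\bigcup_n B n) = \bigcup_n D n.
  by rewrite preimage_bigcup; apply: eq_bigcupr => n _; case: (HB n).
exists (~` \bigcup_n B n); split; first exact: measurableC.
- rewrite -preimage_setC setDE setCK preimage_bigcup setI_bigcupr.
  apply/negligibleP.
    apply: bigcupT_measurable => n; apply: measurableI => //.
    exact: measurable_preim.
  apply: negligible_bigcup => n; apply/negligibleP; last by case: (HB n).
  by apply: measurableI => //; exact: measurable_preim.
- move=> C mC CB C0.
  rewrite -(maxD (f @^-1` C)); last by exists C.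
  rewrite -UBE; congr (mu _); apply/seteqP; split=> [x Cx|x []//]; split=> //.
  exact: CB Cx.
Qed.

(** If no such [E] and [D] existed, the traces on [A] of the preimages of the sets [F i], dense for
    [nu], would approximate every measurable subset of [A]. *)
Lemma charges_split (nu : {finite_measure set Y -> \bar R})
    (K : set X) (B : set Y) :
  (forall C, measurable C -> nu C = mu (f @^-1` C)) ->
  separable_on nu setT -> measurable K -> measurable B ->
  ~ separable_on mu (K `&` f @^-1` B) ->
  exists E D, [/\ measurable E, measurable D, E `<=` K & D `<=` B] /\
    [/\ mu (f @^-1` D) <> 0%E, charges E D & charges (K `\` E) D].
Proof.
move=> nuE [I [F [mF HF]]] mK mB nsepA; set A := K `&` f @^-1` B in nsepA.
have mfB := measurable_preim mB.
have mA : measurable A by exact: measurableI.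
apply: contrapT => noED; apply: nsepA.
exists I, (fun i => A `&` f @^-1` F i); split=> [i|E e mE e0].
  by apply: measurableI => //; exact: measurable_preim.
pose A1 := E `&` A.
have mA1 : measurable A1 by exact: measurableI.
have mA2 : measurable (A `\` A1) by exact: measurableD.
have [C1 [mC1 AC1 C1A]] := essential_image mA1.
have [C2 [mC2 AC2 C2A]] := essential_image mA2.
(* If the essential images C1, C2 of A1 and [A `\` A1] overlap in a null set
   only, then A1 is the trace on A of the preimage of C1, up to the null set N
   below. *)
pose D := C1 `&` C2 `&` B.
have mD : measurable D by apply: measurableI => //; exact: measurableI.
have D0 : mu (f @^-1` D) = 0%E.
  (* [A1] can serve as the subset to split off, since its complement in [K] contains the complement
     in [A], which charges [C2]. *)
  apply: contrapT => D0; apply: noED; exists A1, D; split; split=> //.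
  - by move=> x [_ []].
  - by move=> x [].
  - by apply: charges_subset C1A => // x [[]].
  - apply: charges_subset C2A => //; [exact: measurableD| |by move=> x [[]]].
    by move=> x [[]].
have [i] := HF C1 e mC1 e0; rewrite setIT => Fi.
have mfC1 := measurable_preim mC1; have mfC2 := measurable_preim mC2.
have mfD := measurable_preim mD; have mfF := measurable_preim (mF i).
exists i; apply: le_lt_trans Fi; rewrite nuE; last exact: measurable_symdiff.
pose N := (A1 `\` f @^-1` C1) `|` ((A `\` A1) `\` f @^-1` C2) `|` f @^-1` D.
have mN1 : measurable (A1 `\` f @^-1` C1) by exact: measurableD.
have mN2 : measurable ((A `\` A1) `\` f @^-1` C2) by exact: measurableD.
have mN : measurable N by apply: measurableU => //; exact: measurableU.
have N0 : mu N = 0%E.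
  apply: measure_subU0 D0; first 3 last.
  - by move=> x; apply.
  - by apply: measure_subU0 AC1 AC2 => //; exact: measurableU.
  - by [].
  - exact: measurableU.
  - by [].
have mCF : measurable (f @^-1` (C1 `+` F i)).
  by apply: measurable_preim; exact: measurable_symdiff.
rewrite -[leRHS]add0e -N0; apply: measure_subU => //.
  by apply: measurable_symdiff => //; exact: measurableI.
(* Outside [N], a point of [A] lies in [A1] exactly when its image lies in [C1]; so there the error
   is governed by [C1] against [F i]. *)
move=> x; rewrite /N /D /A1 /A /=.
case: (pselect (E x)); case: (pselect (C1 (f x)));
  by case: (pselect (C2 (f x))); tauto.
Qed.

End charges.

(** * Compact spaces *)

Lemma not_scattered_of_splitting (T : topologicalType) (F : set T)
    (KK : set (set T)) :
  compact F -> KK !=set0 -> KK `<=` closed ->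
  (forall K, KK K -> F `&` K !=set0) ->
  (forall K, KK K -> exists K0 K1,
    [/\ KK K0, KK K1, K0 `<=` K, K1 `<=` K & K0 `&` K1 = set0]) ->
  ~ scattered F.
Proof.
move=> cF [K' KK'] KKcl KKF KKsplit scF.
(* Zorn on open U with [F `\` U] meeting every member of KK: for a maximal U, an
   isolated point x of [F `\` U] would give some K in KK whose trace on
   [F `\` U] is {x}, so K could not contain two disjoint members. *)
pose P (U : set T) := open U /\ forall K, KK K -> (F `&` K) `\` U !=set0.
have [C CP totC|U [[oU KU] maxU]] := @Zorn_bigcup _ P.
  split; first by apply: bigcup_open => V /CP[].
  (* The empty chain is covered by [KKF]. Otherwise the sets left of [F] and [K] after removing
     members of the chain form a filter base; a cluster point avoids each open [V] of the chain. *)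
  move=> K KKK; have [[V0 CV0]|C0] := pselect (C !=set0); last first.
    have [x FKx] := KKF _ KKK; exists x; split=> // -[V CV _].
    by apply: C0; exists V.
  pose G := filter_from C (fun V => (F `&` K) `\` V).
  have GG : ProperFilter G.
    apply: filter_from_proper; last by move=> V /CP[_]; exact.
    apply: filter_from_filter; first by exists V0.
    move=> V W CV CW; have [VW|WV] := totC _ _ CV CW.
    - by exists W => // x [FKx nWx]; split; split=> // /VW.
    - by exists V => // x [FKx nVx]; split; split=> // /WV.
  have GFK : G (F `&` K) by exists V0 => // x [].
  have [x [FKx xG]] := compact_closedI cF (KKcl _ KKK) GG GFK.
  exists x; split=> // -[V CV Vx].
  have GV : G ((F `&` K) `\` V) by exists V.
  have /(xG _ _ GV)[z [[_ nVz] Vz]] : nbhs x V.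
    by apply: open_nbhs_nbhs; split=> //; have [] := CP _ CV.
  exact: nVz Vz.
have [x [/set_mem[Fx nUx] [V Vx VM]]] : isolated (F `\` U) !=set0.
  apply: scF; first by move=> x [].
  by have [x [[Fx _] nUx]] := KU _ KK'; exists x.
apply: (maxU (U `|` V^°)).
  split; first exact: subsetUl.
  move=> /(_ x) UVx; apply/nUx/UVx; right.
  exact: nbhs_singleton (nbhs_interior Vx).
split; first by apply: openU => //; exact: open_interior.
move=> K KKK; apply: contrapT => KUV.
(* By [KUV], enlarging [U] by the interior of [V] swallows the whole remaining trace of [K], and [V]
   contains no remaining point but [x]. *)
have Kx z : F z -> K z -> ~ U z -> z = x.
  move=> Fz Kz nUz; suff : [set x] z by [].
  rewrite -VM; split; last by split.
  apply: contrapT => nVz; apply: KUV; exists z; split=> // -[//|].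
  by move/interior_subset.
have [K0 [K1 [KK0 KK1 K0K K1K K01]]] := KKsplit _ KKK.
have [z0 [[Fz0 Kz0] nUz0]] := KU _ KK0; have [z1 [[Fz1 Kz1] nUz1]] := KU _ KK1.
have zE : z0 = z1 
  by exact: etrans (Kx _ Fz0 (K0K _ Kz0) nUz0) (esym (Kx _ Fz1 (K1K _ Kz1) nUz1)).
have : (K0 `&` K1) z0 by split=> //; rewrite zE.
by rewrite K01.
Qed.

(** * The image of a finite measure under a measurable map *)

Section image_measure.
Context (d d' : measure_display) (X : measurableType d) (Y : measurableType d').
Context (R : realType) (mu : {finite_measure set X -> \bar R}) (f : X -> Y).

(** The measurability proof is an argument so that the finite measure structure can be attached to
    the term itself. *)
Definition image_measure of measurable_fun setT f := pushforward mu f.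

Hypothesis mf : measurable_fun setT f.

Let image_measure0 : image_measure mf set0 = 0%E.
Proof. by rewrite /image_measure /pushforward preimage_set0 measure0. Qed.

Let image_measure_ge0 A : (0 <= image_measure mf A)%E.
Proof. exact: measure_ge0. Qed.

Let image_measure_sigma_additive : semi_sigma_additive (image_measure mf).
Proof.
move=> F mF tF mUF; rewrite /image_measure /pushforward preimage_bigcup.
apply: measure_semi_sigma_additive.
- by move=> n; exact: measurable_preim.
- apply/trivIsetP => /= i j _ _ ij; rewrite -preimage_setI.
  by move/trivIsetP : tF => /(_ _ _ _ _ ij) ->//; rewrite preimage_set0.
- by rewrite -preimage_bigcup; exact: measurable_preim.
Qed.

HB.instance Definition _ := isMeasure.Build _ _ _ (image_measure mf)
  image_measure0 image_measure_ge0 image_measure_sigma_additive.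

Let image_measure_fin : fin_num_fun (image_measure mf).
Proof.
by move=> A mA; apply: (@fin_num_measure _ _ _ mu); exact: measurable_preim.
Qed.

HB.instance Definition _ := Measure_isFinite.Build _ _ _ (image_measure mf)
  image_measure_fin.

End image_measure.

(** * Borel sets and continuous maps *)

Section borel.
Context (T : topologicalType) (x0 : T).

Lemma borel_open (A : set T) : open A -> measurable (A : set (borel x0)).
Proof. exact: sub_sigma_algebra. Qed.

Lemma borel_closed (A : set T) : closed A -> measurable (A : set (borel x0)).
Proof.
by move=> /closed_openC/borel_open/measurableC; rewrite setCK.
Qed.

Lemma borel_compact (A : set T) : hausdorff_space T -> compact A ->
  measurable (A : set (borel x0)).
Proof. by move=> hT /(compact_closed hT)/borel_closed. Qed.

Lemma continuous_borel (U : topologicalType) (u0 : U) (f : T -> U) :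
  continuous f -> measurable_fun setT (f : borel x0 -> borel u0).
Proof.
move=> /continuousP cf.
apply: (measurability (@open U : set (set (borel u0)))) => //.
move=> _ [A oA <-]; rewrite setTI; apply: borel_open; exact: cf.
Qed.

End borel.

(** * Splitting compact sets over a common Borel set of [Y] *)

Section compact_splitting.
Context (R : realType) (X Y : topologicalType) (f : X -> Y) (x0 : X).
Hypotheses (hX : hausdorff_space X) (hY : hausdorff_space Y).
Hypothesis cf : continuous f.
Variable mu : {finite_measure set (borel x0) -> \bar R}.
Hypothesis mu_radon : radon mu.

Let mf : measurable_fun setT (f : borel x0 -> borel (f x0)) :=
  continuous_borel cf.

Let compact_image (K : set X) : compact K -> compact (f @` K).
Proof. by apply: continuous_compact; exact: continuous_subspaceT. Qed.

Local Notation charges E B :=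
  (@charges _ _ (borel x0) (borel (f x0)) R mu f E B).
Local Notation borelX A := (measurable (A : set (borel x0))).
Local Notation borelY B := (measurable (B : set (borel (f x0)))).

(** Inner regularity: a compact [K] in the preimage of [A] has compact image inside [A], whose
    preimage contains [K]. Outer regularity follows by applying this to the complement of [A] and
    taking complements of compact sets, which are open. *)
Lemma radon_image_measure : radon (image_measure mu mf).
Proof.
have inner (A : set Y) : borelY A -> mu (f @^-1` A) =
    ereal_sup [set mu (f @^-1` K) | K in
      [set K : set Y | compact K /\ K `<=` A]].
  move=> mA; have mfA := measurable_preim mf mA.
  apply/eqP; rewrite eq_le; apply/andP; split; last first.
    apply: ge_ereal_sup => _ [K [cK KA] <-]; apply: le_measure; rewrite ?inE//.
      by apply: (measurable_preim mf) => //; exact: borel_compact.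
    by move=> x /KA.
  rewrite {1}(mu_radon mfA).1; apply: ge_ereal_sup => _ [K [cK KA] <-].
  apply: (@le_trans _ _ (mu (f @^-1` (f @` K)))).
    apply: le_measure; rewrite ?inE;
      [exact: borel_compact| |exact: preimage_image].
    apply: (measurable_preim mf) => //.
    by apply: borel_compact => //; exact: compact_image.
  apply: ereal_sup_ubound; exists (f @` K) => //; split; first exact: compact_image.
  by move=> _ [x Kx <-]; exact: KA.
move=> A mA; split; first exact: inner.
apply/eqP; rewrite eq_le; apply/andP; split.
  apply: le_ereal_inf_tmp => _ [U [oU AU] <-]; apply: le_measure; rewrite ?inE//.
  exact: borel_open.
apply/lee_addgt0Pr => e e0.
have fin (B : set Y) : borelY B -> mu (f @^-1` B) \is a fin_num.
  by move=> mB; apply: (@fin_num_measure _ _ _ mu); exact: (measurable_preim mf).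
have mCA : borelY (~` A) by exact: measurableC.
have supfin : ereal_sup [set mu (f @^-1` K) | K in
    [set K : set Y | compact K /\ K `<=` ~` A]] \is a fin_num.
  by rewrite -inner// fin.
have [_ [K [cK KA] <-]] := ub_ereal_sup_adherent e0 supfin.
rewrite -inner//.
have mK : borelY K by exact: borel_compact.
have compl (B : set Y) : borelY B ->
    (mu (f @^-1` B) + mu (f @^-1` (~` B)) = mu setT)%E.
  move=> mB; rewrite -measureU//.
  - by rewrite -preimage_setU setUv preimage_setT.
  - exact: (measurable_preim mf).
  - by apply: (measurable_preim mf) => //; exact: measurableC.
  - by rewrite -preimage_setI setICr preimage_set0.
have cA := compl _ mA; have cKE := compl _ mK.
move=> KA_lt; apply: (@le_trans _ _ (mu (f @^-1` (~` K)))).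
  apply: ereal_inf_lbound; exists (~` K) => //; split.
    by apply: closed_openC; exact: compact_closed.
  by move=> y Ay Ky; exact: KA Ky Ay.
have f1 := fin _ mA; have f2 := fin _ mCA; have f3 := fin _ mK.
have f4 : mu (f @^-1` (~` K)) \is a fin_num by apply: fin; exact: measurableC.
rewrite -[X in (_ <= X + _)%E]/(mu (f @^-1` A)).
move: cA KA_lt; rewrite -cKE.
rewrite -(fineK f1) -(fineK f2) -(fineK f3) -(fineK f4) -!EFinD => -[].
rewrite lte_fin lee_fin; lra.
Qed.

(** Charging makes the part of [E] above [B] non-null, so it contains a compact [K] of positive
    measure. Intersecting [B] with the essential image of [K] makes [K] charge the result;
    intersecting with the image of [K] makes every fiber over it meet [K]. *)
Lemma charges_compact (E : set X) (B : set Y) :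
  borelX E -> borelY B -> mu (f @^-1` B) <> 0%E -> charges E B ->
  exists K B',
    [/\ compact K, K `<=` E, borelY B', B' `<=` B & B' `<=` f @` K] /\
    mu (f @^-1` B') <> 0%E /\ charges K B'.
Proof.
move=> mE mB B0 EB.
have mfB := measurable_preim mf mB.
have mA : borelX (E `&` f @^-1` B) by exact: measurableI.
have A0 : mu (E `&` f @^-1` B) <> 0%E by move=> A0; apply: B0; exact: EB A0.
have : (0 < mu (E `&` f @^-1` B))%E.
  by rewrite lt_neqAle measure_ge0 andbT eq_sym; exact/eqP.
rewrite (mu_radon mA).1 => /ereal_sup_gt[_ [K [cK KA] <-] K0].
have mK : borelX K by exact: borel_compact.
have mfK : borelY (f @` K) by apply: borel_compact => //; exact: compact_image.
have [C [mC KC CK]] := essential_image mu mf mK.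
have mCB : borelY (C `&` B) by exact: measurableI.
have mD : borelY (C `&` B `&` f @` K) by exact: measurableI.
exists K, (C `&` B `&` f @` K); split; split=> //.
- by move=> x /KA[].
- by move=> y [[]].
- move=> D0; move: K0; rewrite lt_neqAle eq_sym => /andP[/eqP K0 _]; apply: K0.
  apply: measure_subU0 KC D0 => //.
  - by apply: measurableD => //; exact: (measurable_preim mf).
  - exact: (measurable_preim mf).
  - move=> x Kx; have [Cx|nCx] := pselect (C (f x)); [right|left] => //.
    by split; [split=> //; have [] := KA _ Kx|exists x].
- by apply: (charges_subset mf mK mK _ _ CK) => // y [[]].
Qed.

Variable nu_sep : separable_on (image_measure mu mf) setT.
Variable X1 : set X.
Hypothesis X1_nowhere : forall A : set X, borelX A -> A `<=` X1 ->
  separable_on mu A -> mu A = 0%E.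

Lemma charges_split_compact (K : set X) (B : set Y) :
  compact K -> K `<=` X1 ->
  borelY B -> mu (f @^-1` B) <> 0%E -> charges K B ->
  exists K0 K1 B',
    [/\ compact K0, compact K1, K0 `<=` K, K1 `<=` K & K0 `&` K1 = set0] /\
    [/\ borelY B', B' `<=` B, mu (f @^-1` B') <> 0%E, charges K0 B' &
        charges K1 B'] /\
    B' `<=` f @` K0 /\ B' `<=` f @` K1.
Proof.
move=> cK KX1 mB B0 KB.
have mK : borelX K by exact: borel_compact.
have mfB := measurable_preim mf mB.
(* Separability would make this part of [X1] null, and then, by charging, the preimage of [B]
   null. *)
have nsep : ~ separable_on mu (K `&` f @^-1` B).
  move=> sep; apply/B0/KB => //; apply: X1_nowhere => //; first exact: measurableI.
  by move=> x [/KX1].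
have nuE (C : set Y) :
  borelY C -> image_measure mu mf C = mu (f @^-1` C) by [].
have [E [D [[mE mD EK DB] [D0 ED KED]]]] :=
  charges_split mf nuE nu_sep mK mB nsep.
have mKdE : borelX (K `\` E) by exact: measurableD.
have [K0 [B0' [[cK0 K0E mB0 B0D B0K0] [B0'0 K0B0]]]] :=
  charges_compact mE mD D0 ED.
(* The second compact set is sought over the Borel set already shrunk for [K0], so that the final
   [B1] works for both. *)
have KEB0 : charges (K `\` E) B0'.
  by apply: (charges_subset mf mKdE mKdE _ B0D KED).
have [K1 [B1 [[cK1 K1E mB1 B1B0 B1K1] [B10 K1B1]]]] :=
  charges_compact mKdE mB0 B0'0 KEB0.
exists K0, K1, B1; split; split=> //.
- by move=> x /K0E /EK.
- by move=> x /K1E[].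
- by apply/seteqP; split=> // x [/K0E Ex /K1E[]].
- split=> //; first by move=> y /B1B0 /B0D /DB.
  have mK0 : borelX K0 by exact: borel_compact.
  by apply: (charges_subset mf mK0 mK0 _ B1B0 K0B0).
- by split=> // y /B1B0 /B0K0.
Qed.

(** Charging allows further splitting; the inclusion in the images puts points of every member of
    [L] over each point of [B]. *)
Let good (L : seq (set X)) (B : set Y) : Prop :=
  [/\ borelY B, mu (f @^-1` B) <> 0%E &
      forall K, K \in L -> [/\ compact K, K `<=` X1, B `<=` f @` K & charges K B]].

Let splits (L L' : seq (set X)) : Prop :=
  forall K, K \in L -> exists K0 K1,
    [/\ K0 \in L', K1 \in L', K0 `<=` K, K1 `<=` K & K0 `&` K1 = set0].

(** The members of [L] are split one at a time. Each splitting shrinks [B], and the compact sets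
    found earlier remain good over the smaller set. *)
Lemma charges_split_seq (L : seq (set X)) (B : set Y) : good L B ->
  exists L' B', [/\ good L' B', B' `<=` B & splits L L'].
Proof.
move=> [mB B0]; elim: L => [|K L IH] LB.
  by exists [::], B; split=> //; split.
have [|L' [B' [[mB' B'0 LB'] B'B LL']]] := IH.
  by move=> H HL; apply: LB; rewrite inE HL orbT.
have [cK KX1 BK KB] := LB _ (mem_head K L).
have mK : borelX K by exact: borel_compact.
have KB' : charges K B' by apply: (charges_subset mf mK mK _ B'B KB).
have [K0 [K1 [B2 [[cK0 cK1 K0K K1K K01]
    [[mB2 B2B' B20 K0B2 K1B2] [B2K0 B2K1]]]]]] :=
  charges_split_compact cK KX1 mB' B'0 KB'.
exists [:: K0, K1 & L'], B2; split; last 2 first.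
- exact: subset_trans B'B.
- move=> H; rewrite inE => /predU1P[->|/LL'[H0 [H1 [H0L' H1L' ? ? ?]]]].
    by exists K0, K1; rewrite !inE !eqxx orbT.
  by exists H0, H1; rewrite !inE H0L' H1L' !orbT.
- split=> // H; rewrite !inE => /or3P[/eqP->|/eqP->|/LB'[cH HX1 B'H HB']].
  + by split=> //; exact: subset_trans KX1.
  + by split=> //; exact: subset_trans KX1.
  + split=> //; first exact: subset_trans B'H.
    have mH : borelX H by exact: borel_compact.
    by apply: (charges_subset mf mH mH _ B2B' HB').
Qed.

Lemma exists_nonscattered_fiber : borelX X1 -> mu X1 <> 0%E ->
  compact [set: X] -> compact [set: Y] ->
  exists y, ~ scattered (f @^-1` [set y]).
Proof.
move=> mX1 X10 cX cY.
have [C [mC XC CX]] := essential_image mu mf mX1.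
have C0 : mu (f @^-1` C) <> 0%E.
  move=> C0; apply: X10; apply: measure_subU0 XC C0 => //.
  - by apply: measurableD => //; exact: (measurable_preim mf).
  - exact: (measurable_preim mf).
  - by move=> x X1x; have [Cx|nCx] := pselect (C (f x)); [right|left].
have [K [B [[cK KX1 mB BC BK] [B0 KB]]]] := charges_compact mX1 mC C0 CX.
have good0 : good [:: K] B.
  by split=> // H; rewrite inE => /eqP ->.
pose S := {LB : seq (set X) * set Y | good LB.1 LB.2}.
have next (s : S) : {s' : S |
    (sval s').2 `<=` (sval s).2 /\ splits (sval s).1 (sval s').1}.
  apply: cid; have [L' [B' [gL' B'B LL']]] := charges_split_seq (svalP s).
  by exists (exist _ (L', B') gL').
have [s [s0 Hs]] := dependent_choice next (exist _ ([:: K], B) good0).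
pose L n := (sval (s n)).1; pose D n := (sval (s n)).2.
have gLD n : good (L n) (D n) by exact: (svalP (s n)).
have decrD m n : (m <= n)%N -> D n `<=` D m.
  elim: n => [|n IH]; first by rewrite leqn0 => /eqP ->.
  rewrite leq_eqVlt => /predU1P[->//|/IH]; apply: subset_trans.
  exact: (Hs n).1.
have D_neq0 n : D n !=set0.
  apply/set0P/eqP => Dn0; have [_ + _] := gLD n; apply.
  by rewrite Dn0 preimage_set0 measure0.
pose G := filter_from [set: nat] D.
have GG : ProperFilter G.
  apply: filter_from_proper => //; apply: filter_from_filter; first by exists 0%N.
  move=> m n _ _; exists (maxn m n) => //.
  by rewrite subsetI; split; apply: decrD; rewrite ?leq_maxl ?leq_maxr.
(* The sets [D n] need not be closed, so [y] is only in their closures. This suffices: for [H] in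
   [L n] the image of [H] is closed and contains [D n], hence contains [y]. *)
have [y [_ Gy]] : [set: Y] `&` cluster G !=set0 by apply: cY; exact: filterT.
pose KK := [set H | exists n, H \in L n].
have KKgood H : KK H -> compact H /\ closed H.
  move=> [n HL]; have [_ _ /(_ _ HL)[cH _ _ _]] := gLD n.
  by split=> //; exact: compact_closed.
exists y; apply: (@not_scattered_of_splitting _ _ KK).
- apply: subclosed_compact cX _ => //; apply: closed_comp => [x _|]; first exact: cf.
  exact: compact_closed (@compact_set1 _ _).
- by exists K, 0%N; rewrite /L s0 inE.
- by move=> H /KKgood[].
- move=> H [n HL]; have [_ _ /(_ _ HL)[cH _ DH _]] := gLD n.
  have : closed (f @` H) by apply: compact_closed => //; exact: compact_image.
  move=> /(_ y)[|x Hx xy]; last by exists x.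
  move=> V Vy; have [z [Dz Vz]] : D n `&` V !=set0 by apply: Gy => //; exists n.
  by exists z; split=> //; exact: DH.
- move=> H [n HL]; have [K0 [K1 [K0L K1L ? ? ?]]] := (Hs n).2 _ HL.
  by exists K0, K1; split=> //; exists n.+1.
Qed.

End compact_splitting.

Theorem theorem2p7 (R : realType) (X Y : topologicalType) (f : X -> Y)
  (X_hausdorff : hausdorff_space X) (X_compact : compact [set: X])
  (Y_MS : in_MS R Y) (f_cont : continuous f)
  (fibers_scattered : forall y : Y, scattered (f @^-1` [set y])) :
  in_MS R X.
Proof.
split=> // x0 mu mu_radon.
have [Y_hausdorff Y_compact Y_sep] := Y_MS.
have nu_sep := separable_measure_on
  (Y_sep _ _ (radon_image_measure X_hausdorff Y_hausdorff f_cont mu_radon)).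
(* Exhausting the sets on which [mu] is separable leaves a remainder: if it is null, [mu] is
   separable; otherwise it serves as [X1], since by maximality its subsets on which [mu] is
   separable are null. *)
pose G := [set A : set (borel x0) | measurable A /\ separable_on mu A].
have [|||D [GD incrD maxD]] := @exhausting_sequence _ _ _ mu G.
- by split=> //; exact: separable_on0.
- by move=> A [].
- move=> A B [mA sA] [mB sB].
  by split; [exact: measurableU|exact: separable_onU].
have mD n : measurable (D n) by case: (GD n).
have mUD : measurable (\bigcup_n D n) by exact: bigcupT_measurable.
have [UD0|UD0] := pselect (mu (~` (\bigcup_n D n)) = 0%E).
  apply: separable_on_setT; apply: (separable_on_exhaustion mD incrD UD0) => n.
  by case: (GD n).
have X1_nowhere (A : set (borel x0)) : measurable A -> A `<=` ~` (\bigcup_n D n) ->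
    separable_on mu A -> mu A = 0%E.
  move=> mA AD sA; rewrite -(maxD A)//; congr (mu _).
  by apply/seteqP; split=> [x Ax|x []//]; split=> //; exact: AD.
have [y /(_ (fibers_scattered y))//] := exists_nonscattered_fiber X_hausdorff
  Y_hausdorff mu_radon nu_sep X1_nowhere (measurableC mUD) UD0 X_compact Y_compact.
Qed.
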